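(* Let $g:[0,\infty)\to\mathbb{R}$ be $g(b)=1+\frac{1-2b}{2}e^{-b}-(b+1)e^{-2b}-\frac12 e^{-3b}$ and let $\alpha=\inf\{b\ge 0: g(b)\ge 1/2\}$. Then for the semi-random graph process, $\tau_{\mathtt{PM}}\ge \alpha\ge 0.93261$.
   Context: Semi-random graph process: start from the empty graph $G_0$ on vertex set $[n]$. In each round $t=1,2,\dots$ a vertex $u_t$ (the ''square'') is chosen independently and uniformly at random from $[n]$; the player, knowing the history and $u_t$, selects a vertex $v_t$ (the ''circle'') and the edge $u_tv_t$ is added, giving $G_t$. A strategy specifies, for each $n$ and $t$, a distribution over $[n]$ for $v_t$ depending on $u_1,v_1,\dots,u_{t-1},v_{t-1},u_t$. For a monotone increasing property $\mathcal{P}$, a strategy $\mathcal{S}$ and $0<q<1$, let $\tau_{\mathcal{P}}(\mathcal{S},q,n)$ be the least $t\ge0$ with $\mathbb{P}[G_t\in\mathcal{P}]\ge q$ (or $\infty$), $\tau_{\mathcal{P}}(q,n)=\inf_{\mathcal{S}}\tau_{\mathcal{P}}(\mathcal{S},q,n)$, and $\tau_{\mathcal{P}}=\lim_{q\to1^-}\limsup_{n\to\infty}\tau_{\mathcal{P}}(q,n)/n$. $\mathtt{PM}$ is the property of having a perfect matching (for odd $n$, a matching saturating all but one vertex). *)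

(* Defs.v *)
From HB Require Import structures.
From mathcomp Require Import all_boot all_order all_algebra.
From mathcomp Require Import all_classical all_reals all_analysis.
Set Implicit Arguments. Unset Strict Implicit. Unset Printing Implicit Defensive.
Import Order.TTheory GRing.Theory Num.Theory.
Local Open Scope classical_set_scope.
Local Open Scope ring_scope.

Section SemiRandom.
Variable R : realType.

(* A history of the process on vertex set 'I_n: the list of rounds
   (u_1,v_1), ..., (u_t,v_t) (square, circle). The graph G_t is the
   (multi)graph on 'I_n whose edges are u_i v_i. *)
Definition history (n : nat) := seq ('I_n * 'I_n).

(* A (randomized) strategy for a fixed n: given the history and the current
   square u_t, a distribution over the circle v_t. *)
Definition strategy (n : nat) := history n -> 'I_n -> {ffun 'I_n -> R}.

Definition valid_strategy (n : nat) (S : strategy n) : Prop :=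
  forall h u, (forall v, 0 <= S h u v) /\ \sum_(v : 'I_n) S h u v = 1.

Definition graph_prop (n : nat) := history n -> Prop.

Fixpoint prob_from (n : nat) (S : strategy n) (P : graph_prop n)
    (h : history n) (k : nat) : R :=
  match k with
  | 0 => if `[< P h >] then 1 else 0
  | k'.+1 => \sum_(u : 'I_n) (n%:R)^-1 *
               \sum_(v : 'I_n) S h u v * prob_from S P (rcons h (u, v)) k'
  end.

Definition prob_at (n : nat) (S : strategy n) (P : graph_prop n) (t : nat) : R :=
  prob_from S P [::] t.

Definition tau_S (n : nat) (P : graph_prop n) (S : strategy n) (q : R) : \bar R :=
  ereal_inf [set (t%:R)%:E | t in [set t : nat | q <= prob_at S P t]].

Definition tau_qn (P : forall n, graph_prop n) (q : R) (n : nat) : \bar R :=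
  ereal_inf [set tau_S (P n) S q | S in [set S : strategy n | valid_strategy S]].

Definition tau_prop (P : forall n, graph_prop n) : \bar R :=
  lim ((fun q : R => limn_esup (fun n : nat => (tau_qn P q n * ((n%:R)^-1)%:E)%E))
        @ at_left 1).

(* Perfect matching: a list M of edges of G (each u_i v_i, either
   orientation), pairwise vertex-disjoint (all endpoints distinct, so no loops),
   of size floor(n/2) (i.e. saturating all vertices, or all but one if n odd). *)
Definition has_pm (n : nat) (h : history n) : Prop :=
  exists M : seq ('I_n * 'I_n),
    [/\ all (fun e => (e \in h) || ((e.2, e.1) \in h)) M,
        uniq ([seq e.1 | e <- M] ++ [seq e.2 | e <- M]) &
        size M = n./2]%N.

Definition PM : forall n, graph_prop n := fun n => @has_pm n.

Definition g_fun (b : R) : R :=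
  1 + (1 - 2 * b) / 2 * expR (- b) - (b + 1) * expR (- (2 * b))
    - 2^-1 * expR (- (3 * b)).

Definition alpha : R := inf [set b : R | 0 <= b /\ 2^-1 <= g_fun b].

End SemiRandom.

(* Main.v *)
Require Import Defs.
From HB Require Import structures.
From mathcomp Require Import all_boot all_order all_algebra.
From mathcomp Require Import all_classical all_reals all_analysis.
From mathcomp Require Import zify ring lra.
Import Order.TTheory GRing.Theory Num.Theory.
Import numFieldNormedType.Exports.
Local Open Scope ring_scope.
Set Implicit Arguments.
Unset Strict Implicit.
Unset Printing Implicit Defensive.

(** Every matching edge uses a square, and each vertex provides at most one, so
   the size of a matching is at most n minus the number of vertices whose square
   is wasted. Besides vertices receiving no square, the following are wasted:
   if x receives exactly one square, with circle y, and y receives a square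
   later, then x and y cannot both use a square, so one of the two is wasted.
   Distinct x yield distinct wasted vertices as soon as one discards those x
   for which y receives exactly one square later, with circle z, and z receives
   a square after that (chains x -> y -> z). Whatever the player does, each of
   these events depends on uniform squares only, up to an error in the
   favourable direction, so the expected size of a matching after bn rounds is
   at most n g(b) + O(1). A perfect matching has size about n/2 > n g(b) for
   b < alpha, which bounds its probability away from 1 by Markov's inequality. *)

Lemma uniq_map_inj (T1 T2 : eqType) (f : T1 -> T2) (s : seq T1) :
  uniq [seq f i | i <- s] -> {in s &, injective f}.
Proof.
elim: s => //= x s IH /andP[nfx us] a b; rewrite !inE.
case/predU1P => [->|as_]; case/predU1P => [->|bs] // fab.
- by rewrite fab map_f in nfx.
- by rewrite -fab map_f in nfx.
- exact: IH.
Qed.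

(** * Stuck vertices limit the size of a matching *)

Section Continuation.
Variables (V : finType) (c : V * V -> V).
Implicit Types (x y z : V) (e : V * V) (h : seq (V * V)).

Fixpoint aft x h : option (V * seq (V * V)) :=
  if h is e :: h' then if e.1 == x then Some (c e, h') else aft x h' else None.

Definition squares h := [seq e.1 | e <- h].

Lemma aft_rcons x h e : aft x (rcons h e) =
  if aft x h is Some (y, h') then Some (y, rcons h' e)
  else if e.1 == x then Some (c e, [::]) else None.
Proof. by elim: h => //= e' h ->; case: ifP. Qed.

Lemma squares_rcons h e x :
  (x \in squares (rcons h e)) = (e.1 == x) || (x \in squares h).
Proof. by rewrite /squares map_rcons mem_rcons inE eq_sym. Qed.

Lemma aft_None x h : (aft x h == None) = (x \notin squares h).
Proof. by elim: h => //= e h IH; rewrite inE [x == _]eq_sym; case: (e.1 =P x). Qed.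

Lemma aft_Some x h y h' : aft x h = Some (y, h') ->
  exists h0 e, [/\ h = h0 ++ e :: h', e.1 = x, c e = y & x \notin squares h0].
Proof.
elim: h => //= e h IH; case: eqVneq => [ex [<- <-]|nex /IH].
  by exists [::], e.
move=> [h0 [e' [-> e'x ce' nx]]]; exists (e :: h0), e'; split => //.
by rewrite inE negb_or eq_sym nex.
Qed.

Lemma aft_cat x h1 h2 : x \notin squares h1 -> aft x (h1 ++ h2) = aft x h2.
Proof.
by elim: h1 => //= e h1 IH; rewrite inE eq_sym negb_or => /andP[/negPf->].
Qed.

(* Uncovered vertices, and the [x] of the header that are not discarded. *)
Definition stuck x h : bool :=
  if aft x h is Some (y, h1) then
    (x \notin squares h1) &&
    (if aft y h1 is Some (z, h2)
     then (y \in squares h2) || (z \notin squares h2) else false)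
  else true.

(* A stuck [x] is charged to itself if the matching does not use its square,
   and otherwise to its circle, which the matching then covers. *)
Lemma stuck_matching h (M : seq (V * V)) :
  (forall e, e.1 != e.2 -> c e = e.2) ->
  {subset M <= h} -> uniq ([seq e.1 | e <- M] ++ [seq e.2 | e <- M]) ->
  (#|[pred x | stuck x h]| + size M <= #|V|)%N.
Proof.
move=> cE Mh; rewrite cat_uniq => /and3P[uM1 dis uM2].
set M1 := [seq e.1 | e <- M] in uM1 dis.
set M2 := [seq e.2 | e <- M] in uM2 dis.
have dis' y : y \in M2 -> y \notin M1 by move=> yM; apply: (hasPn dis).
have stuckM x : stuck x h -> x \in M1 -> exists y h1 z h2,
    [/\ (x, y) \in M, aft x h = Some (y, h1), x \notin squares h1,
        aft y h1 = Some (z, h2) & (y \in squares h2) || (z \notin squares h2)].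
  move=> sx /mapP[e eM xe].
  have [e12 eh] : e.1 != e.2 /\ e \in h.
    split; last exact: Mh.
    apply/negP => /eqP e12; have := dis' e.2 (map_f _ eM).
    by rewrite -e12 map_f.
  move: sx; rewrite /stuck; case aE: (aft x h) => [[y h1]|]; last first.
    by move/eqP: aE; rewrite aft_None xe map_f.
  case/andP => nx; case aE': (aft y h1) => [[z h2]|//] yz.
  exists y, h1, z, h2; split => //.
  have [h0 [e' [hE e'x ce' nx0]]] := aft_Some aE.
  move: eh; rewrite hE mem_cat inE => /or3P[|/eqP ee|].
  - by move=> /(map_f fst); rewrite -xe (negPf nx0).
  - by rewrite -ce' -ee cE // xe -surjective_pairing.
  - by move=> /(map_f fst); rewrite -xe (negPf nx).
pose tgt x := if aft x h is Some (y, _) then y else x.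
pose f x := if x \in M1 then tgt x else x.
have fM2 x : stuck x h -> x \in M1 -> (x, f x) \in M.
  move=> sx xM; rewrite /f xM /tgt.
  by have [y [h1 [z [h2 [? -> _ _ _]]]]] := stuckM x sx xM.
have fM1 x : stuck x h -> f x \notin M1.
  move=> sx; case xM: (x \in M1); last by rewrite /f xM xM.
  by apply: dis'; apply: map_f (fM2 x sx xM).
have finj1 x x' : stuck x h -> stuck x' h -> x \in M1 -> x' \notin M1 ->
    f x <> f x'.
  move=> sx sx' xM x'M; rewrite /f xM (negPf x'M) /tgt.
  have [y [h1 [z [h2 [xyM aE nx aE' yz]]]]] := stuckM x sx xM.
  rewrite aE => yx'; move: sx'; rewrite -yx'.
  have [h0 [e [hE ex ce nx0]]] := aft_Some aE.
  have [yh0|yh0] := boolP (y \in squares (rcons h0 e)).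
    have [h3 [e' [h1E e'y ce' ny3]]] := aft_Some aE'.
    rewrite /stuck; case aY: (aft y h) => [[z' h']|]; last first.
      move/eqP: aY; rewrite aft_None hE h1E /squares !map_cat /= map_cat /=.
      by rewrite !(mem_cat, inE) e'y eqxx !orbT.
    suff -> : y \in squares h' by [].
    have [h4 [e4 [hE4 e4y _ ny4]]] := aft_Some aY.
    have : (2 <= count_mem y (squares h))%N.
      rewrite hE -cat_rcons /squares map_cat count_cat h1E.
      rewrite -[2%N]/(1 + 1)%N leq_add // -has_count has_pred1 //.
      by rewrite map_cat mem_cat /= inE e'y eqxx orbT.
    rewrite hE4 /squares map_cat count_cat /= e4y eqxx.
    move/count_memPn: ny4 => ->.
    by rewrite add0n add1n ltnS -has_count has_pred1.
  rewrite /stuck hE -cat_rcons aft_cat // aE'.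
  case/andP => ny; rewrite (negPf ny) /= in yz.
  by move/eqP: yz => /=; rewrite -aft_None; case: (aft z h2).
have finj : {in [pred x | stuck x h] &, injective f}.
  move=> x x'; rewrite !inE => sx sx' ff.
  case xM: (x \in M1); case x'M: (x' \in M1).
  - have e1 := fM2 _ sx xM; have e2 := fM2 _ sx' x'M; rewrite ff in e1.
    by case: (uniq_map_inj uM2 e1 e2 erefl).
  - by case: (finj1 x x') => //; rewrite x'M.
  - by case: (finj1 x' x) => //; rewrite xM.
  - by move: ff; rewrite /f xM x'M.
pose B := [set f x | x in [pred x | stuck x h]].
have -> : #|[pred x | stuck x h]| = #|B| by rewrite card_in_imset.
rewrite -(size_map fst M) -(card_uniqP uM1) -cardUI.
have -> : #|[predI B & M1]| = 0%N.
  apply/eqP/pred0P => y; rewrite !inE; apply/negP => /andP[].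
  by case/imsetP => x; rewrite inE => sx ->; apply/negP/fM1.
by rewrite addn0 max_card.
Qed.

End Continuation.

(** * A potential whose drift does not depend on the player *)

Section Potential.
Variables (R : realFieldType) (V : finType) (c : V * V -> V).
Hypothesis cN : forall e, c e != e.1.
Hypothesis V3 : (3 <= #|V|)%N.
Implicit Types (x y z u : V) (e : V * V) (h : seq (V * V)) (k : nat).
Let n : R := #|V|%:R.

(* Probability that [k] uniform squares all miss a given set of [m] vertices. *)
Definition miss m k : R := (1 - m%:R / n) ^+ k.

(** For distinct [x], [y], [z], the probability that [k] squares miss [x] and either miss [y] or hit
    [y] exactly once and [z] afterwards; the sum over the round hitting [y] telescopes. *)
Definition open_wt k : R := k%:R / n * miss 2 k.-1 + miss 3 k.

Definition free_wt k : R :=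
  2^-1 * miss 1 k - k%:R / n * miss 1 k.-1 - 2^-1 * miss 3 k
  - k%:R / n * miss 2 k.-1 - miss 2 k.

(* Upper bound for minus the conditional probability that [x] ends up stuck,
   given the history [h] with [k] rounds to go; it is not exact because [z] may
   coincide with [x] or [y]. [free_wt] and [open_wt] solve the recurrences [free_wtS] and [open_wtS]. *)
Definition wt k x h : R :=
  match aft c x h with
  | None => free_wt k
  | Some (y, h1) =>
    if x \in squares h1 then 0 else
    - miss 1 k +
    match aft c y h1 with
    | None => open_wt k
    | Some (z, h2) =>
      if y \in squares h2 then 0 else
      miss 2 k - (if z \in squares h2 then 0 else miss 3 k)
    end
  end.

Let n_gt0 : 0 < n. Proof. by rewrite ltr0n; apply: leq_trans V3. Qed.
Let n_neq0 : n != 0. Proof. by rewrite gt_eqF. Qed.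

Lemma missS m k : n * miss m k.+1 = (n - m%:R) * miss m k.
Proof. by rewrite /miss exprS; field. Qed.

Lemma miss_ge0 m k : (m <= 3)%N -> 0 <= miss m k.
Proof.
move=> m3; rewrite exprn_ge0 // subr_ge0 ler_pdivrMr // mul1r ler_nat.
exact: leq_trans V3.
Qed.

Lemma miss_pred m k : n * (k%:R * miss m k) = (n - m%:R) * (k%:R * miss m k.-1).
Proof. by case: k => [|k]; [rewrite !mul0r !mulr0|rewrite mulrCA missS mulrCA]. Qed.

Lemma open_wtS k :
  n * open_wt k.+1 = (n - 2) * open_wt k + miss 2 k - miss 3 k.
Proof.
rewrite /open_wt /= mulrDr missS.
have -> : n * (k.+1%:R / n * miss 2 k) = miss 2 k + k%:R * miss 2 k.
  by rewrite -natr1; field.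
suff -> : k%:R * miss 2 k = (n - 2) * (k%:R / n * miss 2 k.-1) by ring.
by apply: (mulfI n_neq0); rewrite miss_pred; field.
Qed.

Lemma free_wtS k :
  n * free_wt k.+1 = (n - 1) * free_wt k - miss 1 k + open_wt k.
Proof.
rewrite /free_wt /open_wt /=.
have -> : n * (2^-1 * miss 1 k.+1 - k.+1%:R / n * miss 1 k -
       2^-1 * miss 3 k.+1 - k.+1%:R / n * miss 2 k - miss 2 k.+1) =
   2^-1 * (n * miss 1 k.+1) - (k%:R * miss 1 k + miss 1 k) -
   2^-1 * (n * miss 3 k.+1) - (k%:R * miss 2 k + miss 2 k) - n * miss 2 k.+1.
  by rewrite -natr1; field.
rewrite !missS.
have E m : k%:R * miss m k = (n - m%:R) * (k%:R / n * miss m k.-1).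
  by apply: (mulfI n_neq0); rewrite miss_pred; field.
by rewrite !E; field.
Qed.

Lemma sum_delta (a b d f : R) x y z :
  \sum_u (a + b * (u == x)%:R + d * (u == y)%:R + f * (u == z)%:R)
  = n * a + b + d + f.
Proof.
have delta t : \sum_u (u == t)%:R = 1 :> R.
  by rewrite (bigD1 t) //= eqxx big1 ?addr0 // => i /negPf->.
by rewrite !big_split /= sumr_const -mulr_natl -!mulr_sumr !delta !mulr1.
Qed.

(** A circle just placed has received no square since, so the weight cannot yet tell which vertex it
    is: the player's choice drops out of the averaging. *)
Lemma wt_rcons k x h u v w : wt k x (rcons h (u, v)) = wt k x (rcons h (u, w)).
Proof.
rewrite /wt !aft_rcons; case: (aft c x h) => [[y h1]|] /=; last by case: ifP.
rewrite !squares_rcons /= !aft_rcons; case: ifP => // _.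
case: (aft c y h1) => [[z h2]|] /=; last by case: ifP.
by rewrite !squares_rcons.
Qed.

Lemma wt_step k x h : \sum_u wt k x (rcons h (u, u)) <= n * wt k.+1 x h.
Proof.
(* Only a square at [x], [y] or [z] moves the state, so a bound affine in three indicators
   suffices. *)
pose b (A B C D : R) y z u : R :=
  A + B * (u == x)%:R + C * (u == y)%:R + D * (u == z)%:R.
suff [A [B [C [D [y [z [le_b sum_b]]]]]]] : exists A B C D y z,
   (forall u, wt k x (rcons h (u, u)) <= b A B C D y z u) /\
   n * A + B + C + D = n * wt k.+1 x h.
  by rewrite -sum_b -(sum_delta A B C D x y z); apply: ler_sum.
have P3 := miss_ge0 k (leqnn 3).
have E1 := missS 1 k; have E2 := missS 2 k; have E3 := missS 3 k.
have Eo := open_wtS k; have Ef := free_wtS k.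
have xV u y h1 : aft c x h = Some (y, h1) ->
    aft c x (rcons h (u, u)) = Some (y, rcons h1 (u, u)).
  by move=> ax; rewrite aft_rcons ax.
rewrite /b /wt; case ax: (aft c x h) => [[y h1]|]; last first.
  exists (free_wt k), (open_wt k - miss 1 k - free_wt k), 0, 0, x, x.
  split => [u|]; last by lra.
  by rewrite aft_rcons ax /=; case: (u =P x) => /= _; lra.
have xy : x != y.
  by have [h0 [e [_ <- <- _]]] := aft_Some ax; rewrite eq_sym cN.
case: ifPn => xh1.
  exists 0, 0, 0, 0, x, x; split => [u|]; last by ring.
  by rewrite (xV _ _ _ ax) squares_rcons xh1 orbT; lra.
case ay: (aft c y h1) => [[z h2]|]; last first.
  exists (- miss 1 k + open_wt k), (miss 1 k - open_wt k),
    (miss 2 k - miss 3 k - open_wt k), 0, y, x.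
  split => [u|]; last by lra.
  rewrite (xV _ _ _ ax) squares_rcons (negPf xh1) orbF aft_rcons ay /=.
  case: (u =P x) => [->|_]; first by rewrite (negPf xy) /=; lra.
  by case: (u =P y) => _ /=; lra.
case: ifPn => yh2.
  exists (- miss 1 k), (miss 1 k), 0, 0, x, x.
  split => [u|]; last by lra.
  rewrite (xV _ _ _ ax) squares_rcons (negPf xh1) orbF aft_rcons ay /=.
  rewrite squares_rcons yh2 orbT.
  by case: (u =P x) => _ /=; lra.
case: ifPn => zh2.
  exists (- miss 1 k + miss 2 k), (miss 1 k - miss 2 k), (- miss 2 k), 0, y, x.
  split => [u|]; last by lra.
  rewrite (xV _ _ _ ax) squares_rcons (negPf xh1) orbF aft_rcons ay /=.
  rewrite !squares_rcons (negPf yh2) orbF zh2 orbT /=.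
  case: (u =P x) => [->|_]; first by rewrite (negPf xy) /=; lra.
  by case: (u =P y) => _ /=; lra.
(* Only here can the bound be strict, for instance at [u = x] when [z = x]: the surplus is
   [miss 3 k], nonnegative by [P3]. *)
exists (- miss 1 k + miss 2 k - miss 3 k), (miss 1 k - miss 2 k + miss 3 k),
  (- miss 2 k + miss 3 k), (miss 3 k), y, z.
split => [u|]; last by lra.
rewrite (xV _ _ _ ax) squares_rcons (negPf xh1) orbF aft_rcons ay /=.
rewrite !squares_rcons (negPf yh2) (negPf zh2) !orbF /=.
case: (u =P x) => [->|_].
  by rewrite (negPf xy) /=; case: (x == z) => /=; lra.
by case: (u =P y) => _ /=; case: (u == z) => /=; lra.
Qed.

Lemma wt0 x h : wt 0 x h = - (stuck c x h)%:R.
Proof.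
rewrite /wt /stuck /open_wt /free_wt /miss /= !expr0 !mul0r.
case: (aft c x h) => [[y h1]|]; last by rewrite /=; field.
case: ifP => _ /=; first by rewrite oppr0.
case: (aft c y h1) => [[z h2]|] /=; last by ring.
case: ifP => _ /=; first by ring.
by case: ifP => _ /=; ring.
Qed.

End Potential.

(** * From the potential to the probability of a perfect matching *)

Section ProbabilityBound.
Variables (R : realType) (n : nat).
Hypothesis n3 : (3 <= n)%N.

(* Loops are useless for a matching, so a loop may be redirected anywhere. *)
Definition circle (e : 'I_n * 'I_n) : 'I_n :=
  if e.1 != e.2 then e.2 else odflt e.1 [pick x | x != e.1].

Lemma circle_neq e : circle e != e.1.
Proof.
rewrite /circle; case: ifPn => [|_]; first by rewrite eq_sym.
case: pickP => //= noneq; exfalso.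
have : (#|'I_n| <= #|pred1 e.1|)%N.
  by apply/subset_leq_card/fintype.subsetP => x _; rewrite inE -[_ == _]negbK noneq.
by rewrite card1 card_ord leqNgt (leq_trans _ n3).
Qed.

Lemma has_pm_stuck (h : history n) :
  has_pm h -> (#|[pred x | stuck circle x h]| + n./2 <= n)%N.
Proof.
move=> [M [Mh uM <-]]; rewrite -[leqRHS]card_ord.
(* Turns each matching edge square first, as the history records it. *)
pose o e := if e \in h then e else (e.2, e.1).
rewrite -(size_map o M); apply: stuck_matching.
- by move=> e e12; rewrite /circle e12.
- move=> _ /mapP[e eM ->]; rewrite /o; case: ifP => // neh.
  by have := allP Mh e eM; rewrite neh.
- rewrite (perm_uniq (s2 := [seq e.1 | e <- M] ++ [seq e.2 | e <- M])) //.
  elim: M {Mh uM} => //= e M IH; apply/permP => a.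
  have /permP/(_ a) := IH; rewrite !count_cat /= !count_cat /=.
  have [->|->] /= : o e = e \/ o e = (e.2, e.1) by rewrite /o; case: ifP; [left|right].
    by move=> ?; lia.
  by move=> ?; lia.
Qed.

(** Markov's inequality carried through the recursion: with no round left, the right side is [n]
    minus the number of stuck vertices, at least [n./2] on a perfect matching and nonnegative
    otherwise. Each earlier round uses [wt_rcons] for the circle and [wt_step] for the square. *)
Lemma prob_from_bound (S : strategy R n) k (h : history n) :
  valid_strategy S ->
  prob_from S (@PM n) h k * (n./2)%:R <= n%:R + \sum_x wt R circle k x h.
Proof.
move=> vS; elim: k h => [|k IH] h.
  under eq_bigr do rewrite wt0.
  rewrite sumrN -natr_sum -big_mkcond sum1_card lerBrDl /=.
  case: asboolP => [/has_pm_stuck|_].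
    by rewrite mul1r -natrD ler_nat.
  by rewrite mul0r addr0 ler_nat -[leqRHS]card_ord max_card.
have n0 : 0 < n%:R :> R by rewrite ltr0n (leq_trans _ n3).
have V3 : (3 <= #|'I_n|)%N by rewrite card_ord.
rewrite /= -(ler_pM2l n0) mulr_suml mulr_sumr.
apply: (@le_trans _ _ (\sum_(u : 'I_n)
    (n%:R + \sum_x wt R circle k x (rcons h (u, u))))).
  apply: ler_sum => u _; rewrite !mulrA divff ?gt_eqF// mul1r.
  have [S_ge0 S1] := vS h u.
  set r := leRHS; have -> : r = \sum_v S h u v * r.
    by rewrite -mulr_suml S1 mul1r.
  rewrite mulr_suml; apply: ler_sum => v _.
  rewrite -mulrA ler_wpM2l //; apply: le_trans (IH _) _.
  by rewrite lerD2l; apply: ler_sum => x _; rewrite (wt_rcons _ _ _ _ _ _ _ u).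
rewrite big_split /= sumr_const card_ord -[_%:R *+ _]mulr_natl [leRHS]mulrDr lerD2l.
rewrite exchange_big mulr_sumr; apply: ler_sum => x _ /=.
by have := wt_step R circle_neq V3 k x h; rewrite card_ord.
Qed.

Lemma prob_at_bound (S : strategy R n) t :
  valid_strategy S ->
  prob_at S (@PM n) t * (n./2)%:R <= n%:R * (1 + free_wt R 'I_n t).
Proof.
move=> vS; apply: le_trans (prob_from_bound _ _ vS) _.
by rewrite /wt /= sumr_const card_ord mulrDr mulr1 mulr_natl.
Qed.

End ProbabilityBound.

(** * Comparison of the finite bound with [g_fun] *)

Lemma subX_le (R : realFieldType) (a b : R) k :
  0 <= b -> b <= a -> a <= 1 -> a ^+ k - b ^+ k <= k%:R * (a - b).
Proof.
move=> b0 ba a1; elim: k => [|k IH]; first by rewrite subrr mul0r.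
have a0 := le_trans b0 ba.
have ab k' : b ^+ k' <= a ^+ k' by rewrite lerXn2r.
have ak1 : b ^+ k <= 1 by rewrite exprn_ile1 // (le_trans ba).
have bk0 : 0 <= b ^+ k by rewrite exprn_ge0.
rewrite !exprS -natr1.
have -> : a * a ^+ k - b * b ^+ k = a * (a ^+ k - b ^+ k) + b ^+ k * (a - b) by ring.
rewrite mulrDl mul1r lerD //; last by rewrite ler_piMl // subr_ge0.
by rewrite (le_trans _ IH) // ler_piMl // subr_ge0.
Qed.

Section Analysis.
Variable R : realType.
Implicit Types b : R.

Lemma expRN_le b : 0 <= b -> expR (- b) <= 1 - b + b ^+ 2.
Proof.
move=> b0; rewrite expRN.
have b1 : 0 < 1 + b by lra.
apply: (@le_trans _ _ (1 + b)^-1).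
  by rewrite lef_pV2 ?posrE ?expR_gt0 // expR_ge1Dx.
rewrite -div1r ler_pdivrMr //.
have : 0 <= b ^+ 3 by rewrite exprn_ge0.
by move=> ?; lra.
Qed.

(** With [y = m / n], each factor errs by [exp(-y) - (1 - y) <= y^2 <= 9 / n^2], and [subX_le] adds
    up [t = b n] such errors. *)
Lemma miss_bounds (V : finType) m t b : (m <= 3)%N -> (3 <= #|V|)%N ->
  b = t%:R / #|V|%:R ->
  miss R V m t <= expR (- (m%:R * b)) <= miss R V m t + 9 * b / #|V|%:R.
Proof.
move=> m3 V3 bE; set n : R := #|V|%:R; rewrite /miss -/n.
have n_gt0 : 0 < n by rewrite ltr0n; apply: leq_trans V3.
have x0 : 0 <= m%:R / n by rewrite divr_ge0 // ltW.
have x1 : m%:R / n <= 1.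
  by rewrite ler_pdivrMr // mul1r ler_nat; apply: leq_trans V3.
have eE : expR (- (m%:R * b)) = expR (- (m%:R / n)) ^+ t.
  by rewrite -expRM_natl; congr expR; rewrite bE -/n; field; rewrite gt_eqF.
have le1 : 1 - m%:R / n <= expR (- (m%:R / n)) by exact: expR_ge1Dx.
rewrite eE; apply/andP; split.
  by rewrite lerXn2r // nnegrE ?expR_ge0 // subr_ge0.
rewrite -lerBlDl; apply: le_trans (subX_le _ _ le1 _) _.
- by rewrite subr_ge0.
- by rewrite expR_le1 oppr_le0.
have -> : 9 * b / n = t%:R * (9 / n ^+ 2).
  by rewrite bE -/n; field; rewrite gt_eqF.
rewrite ler_wpM2l //.
have := expRN_le x0; rewrite expr_div_n.
suff : m%:R ^+ 2 / n ^+ 2 <= 9 / n ^+ 2 by lra.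
rewrite ler_wpM2r ?invr_ge0 ?exprn_ge0 ?(ltW n_gt0) //.
by rewrite -natrX ler_nat; case: (m) m3 => [|[|[|[|]]]].
Qed.

Lemma miss_pred_ge (V : finType) m t : (m <= 3)%N -> (3 <= #|V|)%N ->
  miss R V m t <= miss R V m t.-1.
Proof.
move=> m3 V3; have n_gt0 : 0 < #|V|%:R :> R by rewrite ltr0n; apply: leq_trans V3.
rewrite /miss ler_wiXn2l ?leq_pred ?lerBlDr ?lerDl ?divr_ge0 ?(ltW n_gt0) //.
by rewrite subr_ge0 ler_pdivrMr // mul1r ler_nat (leq_trans m3).
Qed.

Lemma free_wt_le (V : finType) t b : (3 <= #|V|)%N -> b = t%:R / #|V|%:R ->
  1 + free_wt R V t <= g_fun b + 9 * b * (2 * b + 2) / #|V|%:R.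
Proof.
move=> V3 bE; rewrite /free_wt /g_fun -bE.
have b0 : 0 <= b by rewrite bE divr_ge0.
have /andP[u1 l1] := miss_bounds (isT : (1 <= 3)%N) V3 bE.
have /andP[_ l2] := miss_bounds (isT : (2 <= 3)%N) V3 bE.
have /andP[_ l3] := miss_bounds (isT : (3 <= 3)%N) V3 bE.
have p1 := miss_pred_ge t (isT : (1 <= 3)%N) V3.
have p2 := miss_pred_ge t (isT : (2 <= 3)%N) V3.
rewrite mul1r in u1 l1.
set d := 9 * b / _ in l1 l2 l3.
(* The four negative terms cost [b], [1/2], [b] and [1] times [d], in total less than [2 b + 2]
   times. *)
have -> : 9 * b * (2 * b + 2) / #|V|%:R = d * (2 * b + 2) by rewrite /d; ring.
have d0 : 0 <= d by rewrite divr_ge0 // mulr_ge0.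
have B1 : b * (expR (- b) - d) <= b * miss R V 1 t.-1 by rewrite ler_wpM2l //; lra.
have B2 : b * (expR (- (2 * b)) - d) <= b * miss R V 2 t.-1 by rewrite ler_wpM2l //; lra.
lra.
Qed.

(** * Monotonicity of [g_fun] and numerical bound on [alpha] *)

Lemma expRN2x (x : R) : expR (- (2 * x)) = expR (- x) ^+ 2.
Proof. by rewrite -mulrN expRM_natl. Qed.

Lemma expRN3x (x : R) : expR (- (3 * x)) = expR (- x) ^+ 3.
Proof. by rewrite -mulrN expRM_natl. Qed.

Lemma is_derive_g_fun b : is_derive b 1 (@g_fun R)
  (expR (- b) * (b - 3/2 + (2 * b + 1) * expR (- b) + 3/2 * expR (- b) ^+ 2)).
Proof.
have -> : @g_fun R = fun b => 1 + (1 - 2 * b) / 2 * expR (- b)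
   - (b + 1) * expR (- b) ^+ 2 - 2^-1 * expR (- b) ^+ 3.
  by apply/funext => x; rewrite /g_fun expRN2x expRN3x.
apply: is_derive_eq.
by rewrite /GRing.scale /=; field.
Qed.

Definition exp_taylor9 (x : R) : R :=
  1 - x * (1 - x / 2 * (1 - x / 3 * (1 - x / 4 * (1 - x / 5 * (1 - x / 6
  * (1 - x / 7 * (1 - x / 8 * (1 - x / 9)))))))).

Lemma is_derive_expR_taylor9 (x : R) :
  is_derive x 1 (fun y => expR y * exp_taylor9 y)
    (- (expR x * x ^+ 9 / (2 * 3 * 4 * 5 * 6 * 7 * 8 * 9))).
Proof.
rewrite /exp_taylor9; apply: is_derive_eq.
by rewrite /GRing.scale /=; field.
Qed.

(* The derivative of [expR x * T(x)], with [T] the Taylor polynomial of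
   [expR (- x)] of odd degree 9, is [- expR x * x ^ 9 / 9! <= 0]. *)
Lemma exp_taylor9_le (x : R) : 0 <= x -> exp_taylor9 x <= expR (- x).
Proof.
move=> x0; pose h y := expR y * exp_taylor9 y.
have dh y : derivable h y 1 by have [] := is_derive_expR_taylor9 y.
have h'_le0 y : y \in `]0, x[%R -> derive1 h y <= 0.
  rewrite in_itv /= => /andP[y0 _].
  rewrite derive1E; have [_ ->] := is_derive_expR_taylor9 y.
  by rewrite oppr_le0 divr_ge0 ?mulr_ge0 ?expR_ge0 ?exprn_ge0 ?ltW.
have := @ler0_derive1_le_cc R h 0 x (fun y _ => dh y) h'_le0.
move=> /(_ (derivable_within_continuous (fun y _ => dh y))) /(_ x 0).
rewrite !in_itv /= !lexx x0 /= => /(_ isT isT isT).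
rewrite /h expR0 mul1r {2}/exp_taylor9 !mul0r subr0.
by rewrite expRN mulrC -ler_pdivlMr ?expR_gt0 // div1r.
Qed.

Let r : R := 93261%:R / 100000%:R.

(** [g_fun r] is below 1/2 by only about two millionths, hence so sharp a fraction; a Taylor
    polynomial of degree 7 would be off by more than [10^-5]. *)
Lemma expRN_r : 863 / 2193 <= expR (- r).
Proof.
apply: le_trans (exp_taylor9_le _); last by rewrite /r; lra.
by rewrite /exp_taylor9 /r; lra.
Qed.

(** Since [2 r > 1], the expression decreases in [x = expR (- r)], so the lower bound [q] on [x]
    suffices. *)
Lemma g_fun_r : g_fun r < 2^-1.
Proof.
rewrite /g_fun expRN2x expRN3x.
set q : R := 863 / 2193; set x := expR (- r).
have qx : q <= x by exact: expRN_r.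
have q0 : 0 <= q by rewrite /q; lra.
have q2 : q ^+ 2 <= x ^+ 2 by rewrite lerXn2r // nnegrE // (le_trans q0).
have q3 : q ^+ 3 <= x ^+ 3 by rewrite lerXn2r // nnegrE // (le_trans q0).
have qr : q ^+ 2 * (r + 1) <= x ^+ 2 * (r + 1) by rewrite ler_wpM2r // /r; lra.
have qs : q * (2 * r - 1) <= x * (2 * r - 1) by rewrite ler_wpM2r // /r; lra.
have : 2^-1 < q * (2 * r - 1) / 2 + q ^+ 2 * (r + 1) + q ^+ 3 / 2.
  by rewrite /q /r; lra.
lra.
Qed.

Lemma g_fun_lt_half b : 0 <= b -> b < r -> g_fun b < 2^-1.
Proof.
move=> b0 br; apply: le_lt_trans g_fun_r.
have dg y : derivable (@g_fun R) y 1 by have [] := is_derive_g_fun y.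
have g'_ge0 y : y \in `]0, r[%R -> 0 <= derive1 (@g_fun R) y.
  rewrite in_itv /= => /andP[y0 yr].
  rewrite derive1E; have [_ ->] := is_derive_g_fun y.
  rewrite mulr_ge0 ?expR_ge0 //; set x := expR (- y).
  have x1 : 1 - y <= x by exact: expR_ge1Dx.
  have x2 : 39 / 100 <= x.
    apply: (@le_trans _ _ (expR (- r))); first by have := expRN_r; lra.
    by rewrite ler_expR lerN2 ltW.
  have x0 : 0 <= x by exact: expR_ge0.
  (* Up to [7/10], [x >= 1 - y] bounds the second factor of the derivative below by
     [1 - y - y^2/2 > 0]; beyond, the constant [39/100] is enough. *)
  have [y7|y7] := leP y (7 / 10).
    have : (1 - y) ^+ 2 <= x ^+ 2 by rewrite lerXn2r // nnegrE; lra.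
    have : (2 * y + 1) * (1 - y) <= (2 * y + 1) * x by rewrite ler_wpM2l //; lra.
    have : y ^+ 2 <= y * (7 / 10) by rewrite expr2 ler_wpM2l // ltW.
    lra.
  have : 0 <= x ^+ 2 by rewrite exprn_ge0.
  have : (2 * y + 1) * (39 / 100) <= (2 * y + 1) * x by rewrite ler_wpM2l //; lra.
  have : 39 / 100 * x <= x ^+ 2 by rewrite expr2 ler_wpM2r.
  lra.
apply: (ger0_derive1_le_cc (fun y _ => dg y) g'_ge0
  (derivable_within_continuous (fun y _ => dg y))).
- by rewrite in_itv /= b0 ltW.
- by rewrite in_itv /= lexx andbT (le_trans b0) // ltW.
- exact: ltW.
Qed.

(** Makes the set defining [alpha] nonempty; the [inf] of an empty set would be the default 0. *)
Lemma g_fun_4 : 2^-1 <= g_fun (4 : R).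
Proof.
have e4 : expR (- 4) <= 1 / 16 :> R.
  have e1 : expR (- 1) <= 2^-1 :> R.
    by rewrite expRN lef_pV2 ?posrE ?expR_gt0 // (le_trans _ (expR_ge1Dx 1)) //; lra.
  have -> : - 4 = 4%:R * (- 1) :> R by rewrite mulrN1.
  rewrite expRM_natl (@le_trans _ _ (2^-1 ^+ 4)) //; last by lra.
  by rewrite lerXn2r // nnegrE ?expR_ge0 //; lra.
rewrite /g_fun expRN2x expRN3x.
set x := expR (- 4); have x0 : 0 <= x by exact: expR_ge0.
have : x ^+ 2 <= 1 / 16 * x by rewrite expr2 ler_wpM2r.
have : x ^+ 3 <= 1 / 16 * x ^+ 2 by rewrite exprS ler_wpM2r // exprn_ge0.
by rewrite -/x in e4; lra.
Qed.

Lemma alpha_ge : 93261%:R / 100000%:R <= alpha R.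
Proof.
apply: lb_le_inf; first by exists 4; split; [lra|exact: g_fun_4].
move=> b [b0 gb]; rewrite leNgt; apply/negP => br.
by have := g_fun_lt_half b0 br; rewrite ltNge gb.
Qed.

Lemma g_fun_lt_alpha b : 0 <= b -> b < alpha R -> g_fun b < 2^-1.
Proof.
move=> b0 ba; rewrite ltNge; apply/negP => gb.
have : alpha R <= b by apply: ge_inf => //; exists 0 => y [].
by rewrite leNgt ba.
Qed.

(** The ratio [t / n] ranges over [[0, b]], so a uniform gap is needed; it exists because the
    continuous [g_fun] attains its maximum there. *)
Lemma g_fun_gap b : 0 <= b -> b < alpha R ->
  exists2 d : R, 0 < d & forall x, 0 <= x -> x <= b -> g_fun x <= 2^-1 - d.
Proof.
move=> b0 ba.
have dg y : derivable (@g_fun R) y 1 by have [] := is_derive_g_fun y.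
have [z zb gz] := EVT_max b0 (derivable_within_continuous (fun y _ => dg y)).
exists (2^-1 - g_fun z); last first.
  by move=> x x0 xb; have := gz x; rewrite in_itv /= x0 xb => /(_ isT); lra.
move: zb; rewrite in_itv /= => /andP[z0 zb].
by rewrite subr_gt0 g_fun_lt_alpha // (le_lt_trans zb).
Qed.

End Analysis.

(** * Passage to the limit in [n] and [q] *)

Section LowerBound.
Variable R : realType.
Local Open Scope classical_set_scope.

(** Ensures that the [lim] in [tau_prop] is a true limit and not a default value. *)
Lemma nondecreasing_at_left_is_cvge (f : R -> \bar R) (a : R) :
  {homo f : x y / x <= y >-> (x <= y)%E} -> cvg (f x @[x --> a^'-]).
Proof.
move=> ndf; apply/cvg_ex.
have /cvg_ex[l fl] : cvg ((f \o -%R) x @[x --> (- a)^'+]).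
  apply: nonincreasing_at_right_is_cvge; near=> b.
  by move=> x y _ _ xy; apply: ndf; rewrite lerN2.
by exists l; apply/cvg_at_leftNP.
Unshelve. all: by end_near. Qed.

Lemma tau_qn_nondecreasing (P : forall n, graph_prop n) n (q q' : R) :
  q <= q' -> (tau_qn P q n <= tau_qn P q' n)%E.
Proof.
move=> qq'; apply: le_ereal_inf_tmp => _ [S vS <-].
apply: le_trans (ereal_inf_lbound _) _; first by exists S.
apply: ereal_inf_le_tmp => _ [t q't <-]; exists t => //=.
exact: le_trans qq' q't.
Qed.

(** Lets the limit superior be bounded along even [n] only, where [n./2] is exactly half of [n]. *)
Lemma limn_esup_ge (u : (\bar R)^nat) (x : \bar R) :
  (forall N, exists2 n, (N <= n)%N & (x <= u n)%E) -> (x <= limn_esup u)%E.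
Proof.
move=> xu; rewrite limn_esup_lim; apply: lime_ge; first exact: is_cvg_esups.
apply: nearW => N; have [n Nn xn] := xu N.
by apply: le_trans xn (ereal_sup_ubound _); exists n.
Qed.

(** For [t < b n] the probability is at most [2 (1/2 - d + d/2) = 1 - d < q]; the condition on
    [18 b (2 b + 2)] makes the error term at most [d / 2]. *)
Lemma tau_qn_PM_ge (b d q : R) m : let n := m.*2 in
  0 <= b -> (forall x, 0 <= x -> x <= b -> g_fun x <= 2^-1 - d) ->
  (3 <= n)%N -> 18 * b * (2 * b + 2) <= d * n%:R -> 1 - d < q ->
  ((b * n%:R)%:E <= tau_qn PM q n)%E.
Proof.
move=> n b0 gb n3 Kn dq.
apply: le_ereal_inf_tmp => _ [S vS <-].
apply: le_ereal_inf_tmp => _ [t qt <-].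
rewrite lee_fin leNgt; apply/negP => tb.
have n_gt0 : 0 < n%:R :> R by rewrite ltr0n (leq_trans _ n3).
have V3 : (3 <= #|'I_n|)%N by rewrite card_ord.
pose x : R := t%:R / #|'I_n|%:R.
have x0 : 0 <= x by rewrite divr_ge0.
have xb : x <= b by rewrite /x card_ord ler_pdivrMr // ltW.
have := prob_at_bound n3 t vS; rewrite leNgt => /negP; apply.
have nE : n%:R = 2 * (n./2)%:R :> R by rewrite /n doubleK -mul2n natrM.
rewrite nE -mulrA mulrCA mulrC ltr_pM2r; last first.
  by rewrite -(pmulr_rgt0 _ (ltr0n R 2)) -nE.
apply: le_lt_trans (lt_le_trans dq qt).
rewrite (@le_trans _ _ (2 * (g_fun x + 9 * x * (2 * x + 2) / n%:R))) //.
  rewrite ler_wpM2l //.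
  by have := @free_wt_le R 'I_n t x V3 erefl; rewrite [X in _ / X%:R]card_ord.
have gx := gb x x0 xb.
have : 9 * x * (2 * x + 2) / n%:R <= d / 2.
  rewrite ler_pdivrMr //.
  have : x * (x + 1) <= b * (b + 1) by rewrite ler_pM //; lra.
  lra.
lra.
Qed.

Lemma alpha_le_tau_PM : ((alpha R)%:E <= tau_prop R PM)%E.
Proof.
have a_gt0 : 0 < alpha R by apply: lt_le_trans (alpha_ge R); lra.
rewrite /tau_prop; set T := fun q : R => limn_esup _.
have cT : cvg (T q @[q --> 1^'-]).
  apply: nondecreasing_at_left_is_cvge => q q' qq'.
  rewrite /T !limn_esup_lim; apply: lee_lim; [exact: is_cvg_esups..|].
  apply: nearW => N; apply: ge_ereal_sup => _ [n Nn <-].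
  apply: le_trans (ereal_sup_ubound _); last by exists n.
  by rewrite lee_wpmul2r ?lee_fin ?invr_ge0 // tau_qn_nondecreasing.
apply/lee_addgt0Pr => e e0.
pose b := Num.max 0 (alpha R - e).
have b0 : 0 <= b by rewrite le_max lexx.
have ba : b < alpha R by rewrite gt_max a_gt0 ltrBlDr ltrDl.
have [d d0 gd] := g_fun_gap b0 ba.
rewrite -leeBlDr // -EFinB.
apply: (@le_trans _ _ b%:E); first by rewrite lee_fin le_max lexx orbT.
apply: lime_ge => //; near=> q.
have dq : 1 - d < q by near: q; apply: nbhs_left_gt; rewrite gtrBl.
apply: limn_esup_ge => N.
pose m := maxn N (maxn 2 (Num.truncn (18 * b * (2 * b + 2) / d)).+1).
have mN : (N <= m.*2)%N by rewrite (leq_trans (leq_maxl _ _ : N <= m)%N) // -addnn leq_addl.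
have m2 : (2 <= m)%N by rewrite !leq_max orbT.
exists m.*2 => //.
have n0 : 0 < m.*2%:R :> R by rewrite ltr0n double_gt0 (leq_trans _ m2).
rewrite lee_pdivlMr // -EFinM.
apply: (tau_qn_PM_ge b0 gd) => //.
  by rewrite (leq_trans _ (_ : 4 <= m.*2)%N) // -[4%N]/(2.*2) leq_double.
rewrite [leRHS]mulrC -ler_pdivrMr //.
apply: le_trans (_ : m%:R <= _); last by rewrite ler_nat -addnn leq_addl.
apply: ltW; apply: lt_le_trans (truncnS_gt _) _.
by rewrite ler_nat !leq_max leqnn !orbT.
Unshelve. all: by end_near. Qed.

End LowerBound.

Theorem theorem2 (R : realType) :
  ((alpha R)%:E <= tau_prop R PM)%E /\ (93261%:R / 100000%:R : R) <= alpha R.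
Proof. by split; [exact: alpha_le_tau_PM|exact: alpha_ge]. Qed.
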